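(* Suppose that the minimum of $F$ over $\mathcal{W}$ is attained and the set $\mathcal{W}^*$ of minimizers is closed, and that there is a constant $G<\infty$ with $\lVert \hat{\boldsymbol g}(\boldsymbol w)\rVert\le G$ for all $\boldsymbol w\in\mathcal{W}$. Suppose that $F$ is convex, assume $S_{\max}>0$, and let $\eta(S)$ be defined as in the context for all $S\in(0,S_{\max})$. Let $(\boldsymbol w_t)_{t\ge 0}$ be generated by the stochastic subgradient algorithm with constant step size $\alpha>0$. Then for every $S\in(0,S_{\max})$, every integer $t\ge T_G(\alpha,S)$ and every positive integer $T$, $$\mathbb{E}\left[F(\bar{\boldsymbol w}_t^T)\right]-F^*\le \frac{\alpha G^2}{2}+\frac{\alpha\, U_G(\alpha,S)}{2T},$$ where $\bar{\boldsymbol w}_t^T=\frac1T\sum_{s=t}^{t+T-1}\boldsymbol w_s$.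
   Context: Setting: $\mathcal{W}\subseteq\mathbb{R}^N$ is a closed convex set, with Euclidean norm $\lVert\cdot\rVert$ and inner product $\langle\cdot,\cdot\rangle$. $F:\mathcal{W}\to\mathbb{R}$ is continuous and convex (possibly non-smooth, not necessarily strongly convex). $F^*=\inf_{\boldsymbol w\in\mathcal{W}}F(\boldsymbol w)$ and $\mathcal{W}^*=\{\boldsymbol w\in\mathcal{W}:F(\boldsymbol w)=F^*\}$. For each $\boldsymbol w\in\mathcal{W}$, $\boldsymbol g(\boldsymbol w)$ is a subgradient: $F(\boldsymbol w')\ge F(\boldsymbol w)+\langle \boldsymbol g(\boldsymbol w),\boldsymbol w'-\boldsymbol w\rangle$ for all $\boldsymbol w'\in\mathcal{W}$. An oracle queried at $\boldsymbol w$ returns a random vector $\hat{\boldsymbol g}(\boldsymbol w)$ (unbiased stochastic subgradient) with $\mathbb{E}[\hat{\boldsymbol g}(\boldsymbol w)\mid\boldsymbol w]=\boldsymbol g(\boldsymbol w)$. Stochastic subgradient algorithm with constant step size $\alpha>0$: $\boldsymbol w_0\in\mathcal{W}$ is a constant (deterministic) vector and $\boldsymbol w_{t+1}=\Pi_{\mathcal{W}}[\boldsymbol w_t-\alpha\hat{\boldsymbol g}(\boldsymbol w_t)]$ for $t\in\{0,1,2,\dots\}$, where $\Pi_{\mathcal{W}}$ is Euclidean projection onto $\mathcal{W}$; here $\mathbb{E}[\hat{\boldsymbol g}(\boldsymbol w_t)\mid\boldsymbol w_t]=\boldsymbol g(\boldsymbol w_t)$. For $\boldsymbol w\in\mathcal{W}$,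 $\boldsymbol w^*$ denotes the unique point of $\mathcal{W}^*$ closest to $\boldsymbol w$; in particular $\boldsymbol w_t^*$ is the point of $\mathcal{W}^*$ closest to $\boldsymbol w_t$. $S_{\max}$ (possibly infinite) is the supremum of the values $S>0$ for which $\{\boldsymbol w\in\mathcal{W}:\lVert\boldsymbol w-\boldsymbol w^*\rVert=S\}$ is nonempty. For $S\in(0,S_{\max})$, $$\eta(S)=\inf_{\boldsymbol w\in\mathcal{W}:\ \lVert\boldsymbol w-\boldsymbol w^*\rVert=S}\frac{|F(\boldsymbol w)-F^*|}{\lVert\boldsymbol w-\boldsymbol w^*\rVert}.$$ Constants (the subscript $G$ on $B_G,r_G,\rho_G,D_G,U_G,T_G$ stands for ''general'' and is unrelated to the bound $G$): $B_G(\alpha,S)=\max\left[\frac{\alpha\eta(S)}{2},S,\frac{\alpha G^2}{\eta(S)}\right]$, $r_G(S)=\frac{3\eta(S)}{24G^2+2\eta(S)G}$, $\rho_G(S)=1-\frac{3\eta(S)^2}{4[24G^2+2\eta(S)G]}$, $D_G(\alpha,S)=\frac{[e^{2Gr_G(S)}-\rho_G(S)]\,e^{r_G(S)B_G(\alpha,S)/\alpha}}{1-\rho_G(S)}$, $U_G(\alpha,S)=\frac{2[D_G(\alpha,S)+1]}{r_G(S)^2}$, and the transient time is $T_G(\alpha,S)=\left\lceil\frac{r_G(S)\lVert\boldsymbol w_0-\boldsymbol w_0^*\rVert}{\alpha\log(1/\rho_G(S))}\right\rceil$.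
   Formalization: The formal theorem additionally assumes η(S) > 0 for the chosen S; when η(S) = 0 (possible for unbounded W*, e.g. F(x,y) = y²/x on x ≥ 1, |y| ≤ 10) the constants B_G, D_G, U_G and T_G divide by zero and the bound is undefined. *)

(* Defs.v *)
From mathcomp Require Export all_boot all_order all_algebra.
From mathcomp Require Export all_classical all_reals all_analysis.
Export Order.TTheory GRing.Theory Num.Theory.
Export numFieldNormedType.Exports.

Set Implicit Arguments.
Unset Strict Implicit.
Unset Printing Implicit Defensive.

Local Open Scope classical_set_scope.
Local Open Scope ring_scope.

Section euclidean.
Context {R : realType} {N : nat}.
Implicit Types (u v x : 'rV[R]_N) (A W : set 'rV[R]_N).

Definition dot u v : R := \sum_(i < N) u ord0 i * v ord0 i.

(* The library norm on row vectors is the sup norm; the topology is the same. *)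
Definition enorm u : R := Num.sqrt (dot u u).

(* A total function, equal to x when A has no point closest to x; a closest
   point exists and is unique when A is nonempty, closed and convex. *)
Definition proj A x : 'rV[R]_N :=
  xget x [set y | A y /\ forall z, A z -> enorm (x - y) <= enorm (x - z)].

Definition subgradient W (F : 'rV[R]_N -> R) (g : 'rV[R]_N -> 'rV[R]_N) :=
  forall w w', W w -> W w' -> F w + dot (g w) (w' - w) <= F w'.

End euclidean.

Section optimum.
Context {R : realType} {N : nat}.
Variables (W : set 'rV[R]_N) (F : 'rV[R]_N -> R).

(* Real infimum: meaningful when F is bounded below on a nonempty W. *)
Definition Fstar : R := inf [set F w | w in W].

Definition Wstar : set 'rV[R]_N := [set w | W w /\ F w = Fstar].

Definition dist_opt (w : 'rV[R]_N) : R := enorm (w - proj Wstar w).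

Definition sphere_opt (S : R) : set 'rV[R]_N :=
  [set w | W w /\ dist_opt w = S].

Definition Smax : \bar R :=
  ereal_sup [set S%:E | S in [set S | 0 < S /\ sphere_opt S !=set0]].

(* For 0 < S < Smax the set is nonempty and bounded below, so inf is the true
   infimum.  It can be 0 when Wstar is unbounded: F (x, y) = y^2 / x on
   {x >= 1, |y| <= 10} has eta = 0 throughout. *)
Definition eta (S : R) : R :=
  inf [set `|F w - Fstar| / dist_opt w | w in sphere_opt S].

End optimum.

(* Here e stands for eta S.  All these formulas presuppose e > 0: for e = 0 they
   divide by zero (e, r_G, 1 - rho_G and ln (1 / rho_G) all vanish). *)
Section constants.
Context {R : realType}.
Variables (G alpha S e : R).

Definition B_G : R :=
  Num.max (alpha * e / 2) (Num.max S (alpha * G ^+ 2 / e)).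

Definition r_G : R := 3 * e / (24 * G ^+ 2 + 2 * e * G).

Definition rho_G : R := 1 - 3 * e ^+ 2 / (4 * (24 * G ^+ 2 + 2 * e * G)).

Definition D_G : R :=
  (expR (2 * G * r_G) - rho_G) * expR (r_G * B_G / alpha) / (1 - rho_G).

Definition U_G : R := 2 * (D_G + 1) / r_G ^+ 2.

(* d0 is the distance from the initial point to the set of minimizers. *)
Definition T_G (d0 : R) : int :=
  Num.ceil (r_G * d0 / (alpha * ln (1 / rho_G))).

End constants.

(* R^N with its Borel sigma-algebra. *)
Notation borelRV R N := (g_sigma_algebraType (@open 'rV[R]_N)).

Section conditional_expectation.
Context {d : measure_display} {Omega : measurableType d} {R : realType}.
Context {N : nat}.
Variable P : probability Omega R.
Local Open Scope ereal_scope.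

(* Z is a version of E[X | Y], coordinate by coordinate: Z is integrable,
   sigma(Y)-measurable, and has the same integral as X on every event of
   sigma(Y).  Integrability of X includes its measurability. *)
Definition is_cond_exp (X : Omega -> 'rV[R]_N) (Y : Omega -> borelRV R N)
    (Z : Omega -> 'rV[R]_N) : Prop :=
  forall i : 'I_N,
    [/\ P.-integrable setT (fun o => (X o ord0 i)%:E),
        P.-integrable setT (fun o => (Z o ord0 i)%:E),
        measurable_fun setT
          ((fun o => Z o ord0 i) : g_sigma_algebra_preimageType Y -> R) &
        forall A : set Omega, g_sigma_algebra_preimage Y A ->
          \int[P]_(o in A) (X o ord0 i)%:E = \int[P]_(o in A) (Z o ord0 i)%:E].

(* E[gh(Y) | Y] = g(Y) for an oracle gh queried at the random point Y, where
   gh w is the random answer at w. *)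
Definition unbiased_at (gh : 'rV[R]_N -> Omega -> 'rV[R]_N)
    (g : 'rV[R]_N -> 'rV[R]_N) (Y : Omega -> 'rV[R]_N) : Prop :=
  is_cond_exp (fun o => gh (Y o) o) Y (fun o => g (Y o)).

End conditional_expectation.

Section algorithm.
Context {Omega : Type} {R : realType} {N : nat}.
Variables (W : set 'rV[R]_N) (alpha : R).

(* gh t w : the random answer of the oracle to its query number t, if made
   at w. *)
Variable gh : nat -> 'rV[R]_N -> Omega -> 'rV[R]_N.
Variable w0 : 'rV[R]_N.

Fixpoint iterate (t : nat) (o : Omega) : 'rV[R]_N :=
  if t is s.+1 then
    proj W (iterate s o - alpha *: gh s (iterate s o) o)
  else w0.

Definition average (t T : nat) (o : Omega) : 'rV[R]_N :=
  T%:R^-1 *: \sum_(t <= s < t + T) iterate s o.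

End algorithm.

(* Main.v *)
Require Import Defs.
From mathcomp Require Import measurable_realfun ring lra.

(** The proof controls the distance [dist_opt] from the iterates to the set of
    minimizers.

    Expanding the square of that distance across one projected step gives
    [step_gap_descent]: the squared distance decreases by 2 alpha times the
    optimality gap, up to alpha^2 G^2 and a noise term.  Summing over the
    averaging window and applying Jensen's inequality ([jensen_average]) bounds
    the expected gap of the average by
    alpha G^2 / 2 + E[dist^2] / (2 alpha T), where the distance is taken at the
    start t of the window.  It remains to bound that second moment
    independently of t, although W may be unbounded.

    This is a drift argument in the style of Hajek.  By convexity, the gap grows
    at least like eta(S) times the distance outside the S-neighbourhood of the
    minimizers ([gap_ge_eta]).  Hence, beyond the radius B_G, the distance
    decreases on average by at least alpha eta / 2 per step, while no step moves
    it by more than alpha G.  A quadratic bound on the exponential turns this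
    into a contraction of the exponential moment E[exp (r dist / alpha)] by the
    factor rho_G, up to the additive constant (1 - rho_G) D_G
    ([step_exp_drift], [expected_exp_drift]).  After T_G steps the contribution
    of the initial point has shrunk below 1, so the exponential moment is at
    most 1 + D_G, and x^2 <= 2 exp (c x) / c^2 turns this into
    E[dist^2] <= alpha^2 U_G.

    The oracle is unbiased conditionally on the current iterate alone.  Both
    one-step inequalities are therefore written pointwise, as a function of the
    iterate w plus the inner product of the noise g(w) - gh with a direction
    depending on w only; such an inner product has mean zero
    ([cond_exp_orthogonal]).  Its integrability is no issue: after finitely many
    steps of length at most alpha G everything is essentially bounded. *)

Set Implicit Arguments.
Unset Strict Implicit.
Unset Printing Implicit Defensive.

Local Open Scope classical_set_scope.
Local Open Scope ring_scope.

(** * Euclidean geometry of row vectors *)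

Section euclidean_geometry.
Context {R : realType} {N : nat}.
Implicit Types (u v x y z p : 'rV[R]_N) (A : set 'rV[R]_N) (a : R).

Lemma dotC u v : dot u v = dot v u.
Proof. by apply: eq_bigr => i _; rewrite mulrC. Qed.

Lemma dotDl u v x : dot (u + v) x = dot u x + dot v x.
Proof. by rewrite -big_split; apply: eq_bigr => i _; rewrite mxE mulrDl. Qed.

Lemma dotZl a u v : dot (a *: u) v = a * dot u v.
Proof. by rewrite mulr_sumr; apply: eq_bigr => i _; rewrite mxE mulrA. Qed.

Lemma dotNl u v : dot (- u) v = - dot u v.
Proof. by rewrite -scaleN1r dotZl mulN1r. Qed.

Lemma dotBl u v x : dot (u - v) x = dot u x - dot v x.
Proof. by rewrite dotDl dotNl. Qed.

Lemma dotDr u v x : dot x (u + v) = dot x u + dot x v.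
Proof. by rewrite !(dotC x) dotDl. Qed.

Lemma dotZr a u v : dot u (a *: v) = a * dot u v.
Proof. by rewrite !(dotC u) dotZl. Qed.

Lemma dotNr u v : dot u (- v) = - dot u v.
Proof. by rewrite !(dotC u) dotNl. Qed.

Lemma dotBr u v x : dot x (u - v) = dot x u - dot x v.
Proof. by rewrite dotDr dotNr. Qed.

Definition dotE := (dotBl, dotBr, dotDl, dotDr, dotNl, dotNr, dotZl, dotZr).

Lemma dot_ge0 u : 0 <= dot u u.
Proof. by apply: sumr_ge0 => i _; rewrite -expr2 sqr_ge0. Qed.

Lemma dotBZ u v a :
  dot (u - a *: v) (u - a *: v) = dot u u - 2 * a * dot u v + a ^+ 2 * dot v v.
Proof. by rewrite !dotE (dotC v u); ring. Qed.

Lemma enorm_ge0 u : 0 <= enorm u.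
Proof. exact: sqrtr_ge0. Qed.

Lemma enorm_sqr u : enorm u ^+ 2 = dot u u.
Proof. by rewrite sqr_sqrtr ?dot_ge0. Qed.

Lemma enormN u : enorm (- u) = enorm u.
Proof. by rewrite /enorm !dotE opprK. Qed.

Lemma enormBC u v : enorm (u - v) = enorm (v - u).
Proof. by rewrite -enormN opprB. Qed.

Lemma enormZ a u : enorm (a *: u) = `|a| * enorm u.
Proof. by rewrite /enorm !dotE mulrA -expr2 sqrtrM ?sqr_ge0// sqrtr_sqr. Qed.

Lemma ler_enorm u v : (enorm u <= enorm v) = (dot u u <= dot v v).
Proof. by rewrite /enorm ler_sqrt// dot_ge0. Qed.

Lemma coord_le_enorm u i : `|u ord0 i| <= enorm u.
Proof.
rewrite -sqrtr_sqr ler_sqrt ?dot_ge0// /dot (bigD1 i)//= -expr2 lerDl.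
by apply: sumr_ge0 => j _; rewrite -expr2 sqr_ge0.
Qed.

Lemma enorm_eq0 u : enorm u = 0 -> u = 0.
Proof.
move=> u0; apply/rowP => i; rewrite mxE; apply/eqP; rewrite -normr_le0 -u0.
exact: coord_le_enorm.
Qed.

Lemma cauchy_schwarz u v : dot u v <= enorm u * enorm v.
Proof.
have [/eqP/enorm_eq0 ->|u0] := boolP (enorm u == 0).
  by rewrite -(scale0r (0 : 'rV[R]_N)) !dotE enormZ normr0 !mul0r.
have [/eqP/enorm_eq0 ->|v0] := boolP (enorm v == 0).
  by rewrite -(scale0r (0 : 'rV[R]_N)) !dotE enormZ normr0 !mul0r mulr0.
have uv0 : 0 < enorm u * enorm v by rewrite mulr_gt0 ?lt_def ?u0 ?v0 ?enorm_ge0.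
have := dot_ge0 (enorm v *: u - enorm u *: v).
rewrite !dotE (dotC v u) -!enorm_sqr => h.
rewrite -(ler_pM2l uv0); lra.
Qed.

Lemma ler_enormD u v : enorm (u + v) <= enorm u + enorm v.
Proof.
rewrite -ler_sqr ?nnegrE ?addr_ge0 ?enorm_ge0// enorm_sqr !dotE (dotC v u).
rewrite -!enorm_sqr; have := cauchy_schwarz u v; lra.
Qed.

Lemma enorm_dist_triangle u v x : enorm (u - v) <= enorm (u - x) + enorm (x - v).
Proof. rewrite (_ : u - v = (u - x) + (x - v)) ?ler_enormD// addrA subrK//. Qed.

(** The library norm of a row vector is the sup norm; this comparison and the
    next one make the two norms define the same notion of continuity. *)
Lemma mxnorm_le_enorm u : `|u| <= enorm u.
Proof.
rewrite [leLHS]/Num.Def.normr/= mx_normrE; apply/bigmax_leP.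
split; first exact: enorm_ge0.
by case=> i j _ /=; rewrite ord1 coord_le_enorm.
Qed.

Lemma enorm_le_mxnorm u : enorm u <= Num.sqrt N%:R * `|u|.
Proof.
rewrite -[X in _ * X]ger0_norm// -sqrtr_sqr -sqrtrM//.
rewrite ler_sqrt; last by rewrite mulr_ge0// sqr_ge0.
rewrite /dot mulrC mulr_natr -[X in _ *+ X]card_ord -sumr_const.
apply: ler_sum => i _; rewrite -expr2 -real_normK ?num_real// ler_sqr ?nnegrE//.
rewrite [leRHS]/Num.Def.normr/= mx_normrE; apply/bigmax_geP; right.
by exists (ord0, i).
Qed.

End euclidean_geometry.

(** * Projection onto a closed convex set *)

Section projection.
Context {R : realType} {N : nat}.
Implicit Types (u v x y z p : 'rV[R]_N) (A : set 'rV[R]_N) (a : R).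

(** Continuity is meant for the sup-norm topology; every continuity claim
    below reduces to a Lipschitz estimate for the Euclidean norm. *)
Lemma enorm_lipschitz_continuous (V : normedModType R) (f : 'rV[R]_N -> V) :
  (forall x y, `|f x - f y| <= enorm (x - y)) -> continuous f.
Proof.
move=> fL x; apply/(cvgrPdist_le (FF := nbhs_filter x)) => e e0.
pose c := Num.sqrt N%:R + 1 : R.
have c0 : 0 < c by rewrite ltr_wpDl ?sqrtr_ge0.
near=> y; apply: (le_trans (fL _ _)); apply: (le_trans (enorm_le_mxnorm _)).
apply: (@le_trans _ _ (c * `|x - y|)); first by rewrite ler_wpM2r// lerDl.
rewrite -ler_pdivlMl// mulrC; near: y.
by apply: cvgr_dist_le; [exact: cvg_id|rewrite divr_gt0].
Unshelve. all: by end_near. Qed.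

(** Minimizing over the part of [A] inside a ball makes the domain compact. *)
Lemma closest_point_exists A x : closed A -> A !=set0 ->
  exists2 p, A p & forall z, A z -> enorm (x - p) <= enorm (x - z).
Proof.
move=> Acl [a Aa].
pose f := fun y : 'rV[R]_N => enorm (x - y).
have fc : continuous f.
  apply: enorm_lipschitz_continuous => y z; rewrite ler_norml /f.
  have h1 := enorm_dist_triangle x y z; have h2 := enorm_dist_triangle x z y.
  by rewrite (enormBC z) in h1; apply/andP; split; lra.
pose B := A `&` [set y | f y <= f a].
have Bc : compact B.
  apply: bounded_closed_compact; last first.
    apply: closedI => //; apply: (preimage_closed _ (@closed_le _ (f a))) => y _.
    exact: fc.
  exists (enorm x + f a); split; first exact: num_real.
  move=> M ltM y [_ /= fy]; apply: (le_trans (mxnorm_le_enorm y)); apply: ltW.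
  apply: le_lt_trans ltM; rewrite -[y](subrK x) addrC.
  by apply: (le_trans (ler_enormD _ _)); rewrite lerD2l enormBC.
have [] := @EVT_min_rV R N f B _ Bc; first by exists a; split => /=.
  by apply: continuous_subspaceT.
move=> p /set_mem[Ap fp] pmin; exists p => // z Az.
have [zB|zB] := leP (f z) (f a); first by apply: pmin; rewrite inE.
exact: le_trans fp (ltW zB).
Qed.

Lemma projP A x : closed A -> A !=set0 ->
  A (proj A x) /\ forall z, A z -> enorm (x - proj A x) <= enorm (x - z).
Proof.
move=> Acl A0; have [p Ap pmin] := closest_point_exists x Acl A0.
by rewrite /proj; case: xgetP => [y _ //|/(_ p)[]].
Qed.

Lemma convex_set_conv A x y a : convex_set A -> A x -> A y -> 0 <= a <= 1 ->
  A (a *: x + (1 - a) *: y).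
Proof.
move=> Acv Ax Ay /andP[a0 a1].
have := Acv x y (Itv01 a0 a1); rewrite !inE; exact.
Qed.

(** Moving from [p] towards [z] by a small step would otherwise decrease the
    distance to [x] at first order. *)
Lemma closest_obtuse A x p : convex_set A -> A p ->
  (forall z, A z -> enorm (x - p) <= enorm (x - z)) ->
  forall z, A z -> dot (x - p) (z - p) <= 0.
Proof.
move=> Acv Ap pmin z Az; rewrite leNgt; apply/negP => d0.
set d := dot _ _ in d0; pose n := dot (z - p) (z - p).
have n0 : 0 <= n := dot_ge0 _.
(* the step length d / (d + n) makes the first-order decrease dominate *)
pose a := d / (d + n).
have dn : 0 < d + n by rewrite ltr_wpDr.
have a0 : 0 < a by rewrite divr_gt0.
have a1 : a <= 1 by rewrite ler_pdivrMr// mul1r lerDl.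
have aA : A (a *: z + (1 - a) *: p).
  by apply: convex_set_conv => //; rewrite (ltW a0).
have /pmin := aA; rewrite ler_enorm.
rewrite (_ : x - (_ + _) = (x - p) - a *: (z - p)); last first.
  by apply/rowP => i; rewrite !mxE; ring.
rewrite dotBZ -/d -/n => h.
have : a * n < 2 * d.
  by rewrite /a mulrAC ltr_pdivrMr//; nra.
nra.
Qed.

Lemma proj_in A x : closed A -> A !=set0 -> A (proj A x).
Proof. by move=> Acl A0; case: (projP x Acl A0). Qed.

Lemma proj_min A x z : closed A -> A !=set0 -> A z ->
  enorm (x - proj A x) <= enorm (x - z).
Proof. by move=> Acl A0; case: (projP x Acl A0) => _; apply. Qed.

Lemma proj_obtuse A x z : closed A -> convex_set A -> A z ->
  dot (x - proj A x) (z - proj A x) <= 0.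
Proof.
move=> Acl Acv Az; have A0 : A !=set0 by exists z.
by have [Ap pmin] := projP x Acl A0; exact: (closest_obtuse Acv Ap pmin).
Qed.

(** Adding the two obtuse-angle inequalities for two candidate points shows
    that they coincide. *)
Lemma obtuse_proj A x p : closed A -> convex_set A -> A p ->
  (forall z, A z -> dot (x - p) (z - p) <= 0) -> proj A x = p.
Proof.
move=> Acl Acv Ap pobt; set q := proj A x.
have A0 : A !=set0 by exists p.
have h1 := pobt q (proj_in x Acl A0); have h2 := proj_obtuse x Acl Acv Ap.
rewrite -/q in h2.
apply/eqP; rewrite -subr_eq0; apply/eqP/enorm_eq0/eqP.
rewrite -sqrf_eq0 enorm_sqr eq_le dot_ge0 andbT.
move: h1 h2; rewrite !dotE (dotC q p); lra.
Qed.

Lemma proj_id A x : closed A -> convex_set A -> A x -> proj A x = x.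
Proof.
move=> Acl Acv Ax; apply: obtuse_proj => // z _.
by rewrite subrr -(scale0r x) dotZl mul0r.
Qed.

(** Adding the obtuse-angle inequalities at both projections gives
    |p - q|^2 <= <p - q, x - y>, and Cauchy-Schwarz concludes. *)
Lemma proj_nonexpansive A x y : closed A -> convex_set A -> A !=set0 ->
  enorm (proj A x - proj A y) <= enorm (x - y).
Proof.
move=> Acl Acv A0; set p := proj A x; set q := proj A y.
have h1 := proj_obtuse x Acl Acv (proj_in y Acl A0).
have h2 := proj_obtuse y Acl Acv (proj_in x Acl A0).
rewrite -/p -/q in h1 h2.
have h3 : dot (p - q) (p - q) <= dot (p - q) (x - y).
  move: h1 h2; rewrite !dotE (dotC q p) (dotC x p) (dotC x q) (dotC y p) (dotC y q).
  lra.
have := le_trans h3 (cauchy_schwarz _ _); rewrite -enorm_sqr expr2.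
have [->|n0] := eqVneq (enorm (p - q)) 0; first by rewrite enorm_ge0.
by rewrite ler_pM2l// lt_def n0 enorm_ge0.
Qed.

Lemma proj_continuous A : closed A -> convex_set A -> A !=set0 ->
  continuous (proj A).
Proof.
move=> Acl Acv A0; apply: enorm_lipschitz_continuous => x y.
by apply: (le_trans (mxnorm_le_enorm _)); exact: proj_nonexpansive.
Qed.

(** Since [proj A] is continuous and takes its values in [A], it extends a
    function continuous within [A] to one that is continuous everywhere, hence
    Borel measurable. *)
Lemma continuous_comp_proj A (f : 'rV[R]_N -> R) :
  closed A -> convex_set A -> A !=set0 -> {within A, continuous f} ->
  continuous (f \o proj A).
Proof.
move=> Acl Acv A0 /subspace_continuousP fA x.
have Ax := proj_in x Acl A0.
apply: cvg_trans (fA _ Ax) => U /= nU.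
have := proj_continuous Acl Acv A0 nU.
apply: (@filterS _ _ (nbhs_filter x)) => y; apply; exact: proj_in.
Qed.

Lemma dist_proj_lipschitz A x y : closed A -> A !=set0 ->
  enorm (x - proj A x) <= enorm (y - proj A y) + enorm (x - y).
Proof.
move=> Acl A0; apply: (le_trans (proj_min x Acl A0 (proj_in y Acl A0))).
by rewrite [leRHS]addrC; exact: enorm_dist_triangle.
Qed.

End projection.

(** * Convex minimization *)

Section convex_minimization.
Context {R : realType} {N : nat}.
Context (W : set 'rV[R]_N) (F : 'rV[R]_N -> R).
Hypotheses (W_closed : closed W) (W_convex : convex_set W).
Hypothesis F_convex : convex_function W F.
Hypothesis F_min : exists2 w, W w & forall w', W w' -> F w <= F w'.
Hypothesis Wstar_closed : closed (Wstar W F).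
Implicit Types (w x y : 'rV[R]_N) (a : R).

Let Fs := Fstar W F.
Let Ws := Wstar W F.
Let dist := dist_opt W F.

Lemma convex_functionE x y a : W x -> W y -> 0 <= a <= 1 ->
  F (a *: x + (1 - a) *: y) <= a * F x + (1 - a) * F y.
Proof.
move=> Wx Wy /andP[a0 a1].
by have := F_convex (Itv01 a0 a1) (mem_set Wx) (mem_set Wy).
Qed.

Lemma Fstar_argmin : exists2 w, W w & F w = Fs.
Proof.
have [w Ww wmin] := F_min; exists w => //.
apply/eqP; rewrite eq_le; apply/andP; split.
  by apply: lb_le_inf; [exists (F w), w|move=> _ [w' Ww' <-]; exact: wmin].
by apply: ge_inf; [exists (F w) => _ [w' Ww' <-]; exact: wmin|exists w].
Qed.

Lemma Fstar_le w : W w -> Fs <= F w.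
Proof.
have [w' Ww' w'min] := F_min; move=> Ww.
by apply: ge_inf; [exists (F w') => _ [v Wv <-]; exact: w'min|exists w].
Qed.

Lemma Wstar_neq0 : Ws !=set0.
Proof. by have [w Ww Fw] := Fstar_argmin; exists w. Qed.

Lemma Wstar_convex : convex_set Ws.
Proof.
move=> x y a; rewrite !inE => -[Wx Fx] [Wy Fy].
have a01 : 0 <= a%:num <= 1 by apply/andP; split; [exact: ge0|exact: le1].
have Wxy : W (a%:num *: x + (1 - a%:num) *: y) by exact: convex_set_conv.
split => //; apply/eqP; rewrite eq_le Fstar_le// andbT.
by apply: (le_trans (convex_functionE Wx Wy a01)); rewrite Fx Fy; lra.
Qed.

Lemma proj_Wstar w : Ws (proj Ws w).
Proof. exact: proj_in Wstar_closed Wstar_neq0. Qed.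

Lemma dist_opt_lipschitz x y : dist x <= dist y + enorm (x - y).
Proof. exact: dist_proj_lipschitz Wstar_closed Wstar_neq0. Qed.

Lemma dist_opt_ge0 w : 0 <= dist w.
Proof. exact: enorm_ge0. Qed.

Lemma dist_opt_continuous : continuous dist.
Proof.
apply: enorm_lipschitz_continuous => x y; rewrite ler_norml.
have h1 := dist_opt_lipschitz x y; have h2 := dist_opt_lipschitz y x.
by rewrite (enormBC y) in h2; apply/andP; split; lra.
Qed.

Lemma gap_le_dot g w : subgradient W F g -> W w ->
  F w - Fs <= dot (g w) (w - proj Ws w).
Proof.
move=> gF Ww; have [Wp Fp] := proj_Wstar w.
by have := gF _ _ Ww Wp; rewrite Fp -(opprB w) dotNr -/Fs; lra.
Qed.

(** The point [z] at distance [S] from the minimizers on the segment from the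
    projection of [w] to [w] still projects to the same minimizer, so eta bounds
    its gap from below; convexity carries the bound from [z] to [w]. *)
Lemma gap_ge_eta (S : R) w : 0 < S -> W w -> S <= dist w ->
  eta W F S * dist w <= F w - Fs.
Proof.
move=> S0 Ww Sw; set p := proj Ws w; have [Wp Fp] := proj_Wstar w.
have d0 : 0 < dist w := lt_le_trans S0 Sw.
pose a := S / dist w.
have a0 : 0 < a by rewrite divr_gt0.
have a1 : a <= 1 by rewrite ler_pdivrMr// mul1r.
have a01 : 0 <= a <= 1 by rewrite (ltW a0).
pose z := a *: w + (1 - a) *: p.
have Wz : W z by exact: convex_set_conv.
have zp : z - p = a *: (w - p) by apply/rowP => i; rewrite !mxE; ring.
have projz : proj Ws z = p.
  apply: obtuse_proj => //; first exact: Wstar_convex.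
  move=> q Wq; rewrite zp dotZl pmulr_rle0//.
  by apply: proj_obtuse => //; exact: Wstar_convex.
have dz : dist z = S.
  rewrite /dist /dist_opt -/Ws projz zp enormZ gtr0_norm//.
  by rewrite -/(dist w) divfK// gt_eqF.
have Fz : F z - Fs <= a * (F w - Fs).
  have := convex_functionE Ww Wp a01; rewrite -/p -/z Fp -/Fs; lra.
have etaz : eta W F S <= (F z - Fs) / S.
  apply: ge_inf.
    by exists 0 => _ [v [Wv vS] <-]; rewrite divr_ge0// dist_opt_ge0.
  by exists z => //; rewrite -/dist dz ger0_norm// subr_ge0 Fstar_le.
move: etaz; rewrite ler_pdivlMr// => /le_trans/(_ Fz).
by rewrite /a mulrAC ler_pdivlMr// mulrAC [S * _]mulrC ler_pM2r.
Qed.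

End convex_minimization.

Section jensen.
Context {R : realType} {N : nat}.
Context (W : set 'rV[R]_N) (F : 'rV[R]_N -> R).
Hypothesis W_convex : convex_set W.
Hypothesis F_convex : convex_function W F.

(** The average of n + 2 points is a convex combination of the average of the
    first n + 1 and the last one. *)
Lemma jensen_average (w : nat -> 'rV[R]_N) (t n : nat) :
  (forall s, W (w s)) -> (0 < n)%N ->
  W (n%:R^-1 *: \sum_(t <= s < t + n) w s) /\
  F (n%:R^-1 *: \sum_(t <= s < t + n) w s)
    <= n%:R^-1 * \sum_(t <= s < t + n) F (w s).
Proof.
move=> Ww; case: n => // n _; elim: n => [|n [Wn Fn]].
  by rewrite invr1 scale1r mul1r addn1 !big_nat1.
set m := n.+1%:R in Wn Fn; set x := m^-1 *: _ in Wn Fn.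
have m0 : 0 < m by rewrite ltr0n.
pose a := m / (m + 1).
have m1 : 0 < m + 1 by lra.
have mE : n.+2%:R = m + 1 :> R by rewrite -natr1.
have a01 : 0 <= a <= 1.
  rewrite divr_ge0 ?(ltW m0) ?(ltW m1)//=.
  by rewrite ler_pdivrMr// mul1r lerDl.
have aE : 1 - a = (m + 1)^-1 by rewrite /a; field; rewrite gt_eqF.
have am : a * m^-1 = (m + 1)^-1 by rewrite /a; field; rewrite !gt_eqF.
rewrite mE (addnS t n.+1) !big_nat_recr ?leq_addr//=.
set u := \sum_(_ <= _ < _) w _; set f := \sum_(_ <= _ < _) F _.
have -> : (m + 1)^-1 *: (u + w (t + n.+1)%N) = a *: x + (1 - a) *: w (t + n.+1)%N.
  by rewrite /x scalerA am aE scalerDr.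
split; first exact: convex_set_conv.
apply: (le_trans (convex_functionE F_convex Wn (Ww _) a01)).
rewrite aE mulrDr lerD2r -am -mulrA ler_wpM2l//; by case/andP: a01.
Qed.

End jensen.

(** * Borel measurability of random vectors *)

Section borel_vectors.
Context {R : realType} {N : nat}.

Lemma continuous_borel_measurable (f : 'rV[R]_N -> R) :
  continuous f -> measurable_fun [set: borelRV R N] f.
Proof.
move=> fc; apply: (measurability _ (RGenOpens.measurableE R)).
move=> _ [_ [a [b ->] <-]]; rewrite setTI.
apply: sub_sigma_algebra; move/continuousP: fc; apply; exact: interval_open.
Qed.

Lemma continuous_borel_measurable_rV (f : 'rV[R]_N -> 'rV[R]_N) :
  continuous f ->
  measurable_fun [set: borelRV R N] (f : borelRV R N -> borelRV R N).
Proof.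
move=> fc; apply: (measurability (rT := borelRV R N) (@open 'rV[R]_N)).
  by [].
move=> _ [U oU <-]; rewrite setTI.
by apply: sub_sigma_algebra; move/continuousP: fc; apply.
Qed.

(** The Borel sigma-algebra of row vectors is generated by boxes: an open set
    is the countable union of the half-open boxes of side 1/(n+1)
    with integer index that it contains. *)
Lemma coord_measurable_rV d (T : measurableType d) (X : T -> 'rV[R]_N) :
  (forall i, measurable_fun [set: T] (fun o => X o ord0 i)) ->
  measurable_fun [set: T] (X : T -> borelRV R N).
Proof.
move=> mX; apply: (measurability (rT := borelRV R N) (@open 'rV[R]_N)).
  by [].
move=> _ [U oU <-]; rewrite setTI.
pose box (n : nat) (k : {ffun 'I_N -> int}) : set 'rV[R]_N :=
  [set x | forall i, (k i)%:~R <= x ord0 i * n.+1%:R < (k i)%:~R + 1].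
pose D (nk : nat * {ffun 'I_N -> int}) : set T :=
  if `[< box nk.1 nk.2 `<=` U >] then X @^-1` box nk.1 nk.2 else set0.
have -> : X @^-1` U = \bigcup_nk D nk.
  apply/seteqP; split => [w Uw | w [[n k] _] ]; last first.
    by rewrite /D /=; case: asboolP => // bU /bU.
  have /nbhs_ballP [e /= e0 eU] : nbhs (X w) U by exact: open_nbhs_nbhs.
  pose n := Num.truncn e^-1.
  pose k := [ffun i => Num.floor (X w ord0 i * n.+1%:R)] : {ffun 'I_N -> int}.
  have Xk : box n k (X w) by move=> i; rewrite ffunE -intrD1 floor_itv.
  exists (n, k) => //; rewrite /D /= asboolT// => y yk; apply: eU.
  split => // i j; rewrite ord1 /ball/=.
  have n0 : 0 < n.+1%:R :> R by rewrite ltr0n.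
  rewrite -(ltr_pM2r n0) -[X in _ * X]gtr0_norm// -normrM mulrBl.
  have ne : 1 < e * n.+1%:R.
    rewrite mulrC -ltr_pdivrMr// div1r.
    have e1 : 0 <= e^-1 by rewrite invr_ge0 ltW.
    by case/andP: (truncn_itv e1).
  case/andP: (yk j) => ? ?; case/andP: (Xk j) => ? ?.
  by rewrite ltr_norml; apply/andP; split; lra.
apply: countable_bigcupT_measurable => [|[n k]]; first exact: countableP.
rewrite /D; case: asboolP => // _; rewrite /=.
rewrite (_ : _ @^-1` _ = \bigcap_(i in [set: 'I_N])
    ((fun o => X o ord0 i * n.+1%:R) @^-1` `[(k i)%:~R, (k i)%:~R + 1[)); last first.
  apply/seteqP; split => o; first by move=> h i _; rewrite /= in_itv/= h.
  by move=> h i; have := h i I; rewrite /= in_itv.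
apply: fin_bigcap_measurable => // i _; rewrite -[X in measurable X]setTI.
by apply: measurable_funM => //; exact: measurable_itv.
Qed.
End borel_vectors.

(** * Essentially bounded random variables and conditional expectation *)

Section essentially_bounded.
Context {d : measure_display} {T : measurableType d} {R : realType}.
Context (P : probability T R).
Implicit Types (f g : T -> R) (a K : R).

Definition ess_bounded f :=
  measurable_fun [set: T] f /\ exists K, {ae P, forall o, `|f o| <= K}.

Lemma ess_bounded_integrable f :
  ess_bounded f -> P.-integrable [set: T] (EFin \o f).
Proof.
move=> [mf [K fK]]; apply/integrableP; split; first exact/measurable_EFinP.
apply: (@le_lt_trans _ _ (\int[P]_(o in [set: T]) (Num.max K 0)%:E)%E).
  apply: ae_ge0_le_integral => //.
  - by apply: measurableT_comp => //; exact/measurable_EFinP.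
  - by move=> o _; rewrite lee_fin le_max lexx orbT.
  - by apply: filterS fK => o fo _; rewrite /= lee_fin le_max fo.
rewrite integral_cst//=.
by rewrite probability_setT mule1 ltry.
Qed.

Lemma ess_bounded_cst a : ess_bounded (fun=> a).
Proof. by split => //; exists `|a|; exact: aeW. Qed.

Lemma ess_boundedD f g :
  ess_bounded f -> ess_bounded g -> ess_bounded (fun o => f o + g o).
Proof.
move=> [mf [K fK]] [mg [L gL]]; split; first exact: measurable_funD.
exists (K + L); apply: filterS2 fK gL => o fo go.
by rewrite (le_trans (ler_normD _ _))// lerD.
Qed.

Lemma ess_boundedM f g :
  ess_bounded f -> ess_bounded g -> ess_bounded (fun o => f o * g o).
Proof.
move=> [mf [K fK]] [mg [L gL]]; split; first exact: measurable_funM.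
by exists (K * L); apply: filterS2 fK gL => o fo go; rewrite normrM ler_pM.
Qed.

Lemma ess_boundedZ a f : ess_bounded f -> ess_bounded (fun o => a * f o).
Proof. by apply: ess_boundedM; exact: ess_bounded_cst. Qed.

Lemma ess_boundedX f n : ess_bounded f -> ess_bounded (fun o => f o ^+ n).
Proof.
move=> bf; elim: n => [|n IH]; first exact: ess_bounded_cst.
rewrite (_ : (fun o => _) = (fun o => f o * f o ^+ n)); first exact: ess_boundedM.
by apply/funext => o; rewrite exprS.
Qed.

Lemma ess_bounded_expR f : ess_bounded f -> ess_bounded (fun o => expR (f o)).
Proof.
move=> [mf [K fK]]; split; first exact: measurableT_comp.
exists (expR K); apply: filterS fK => o fo.
by rewrite ger0_norm ?expR_ge0// ler_expR (le_trans (ler_norm _)).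
Qed.

Lemma ess_bounded_sum (I : Type) (s : seq I) (f : I -> T -> R) :
  (forall i, ess_bounded (f i)) -> ess_bounded (fun o => \sum_(i <- s) f i o).
Proof.
move=> bf; elim: s => [|i s IH].
  rewrite (_ : (fun o => _) = (fun=> 0)); first exact: ess_bounded_cst.
  by apply/funext => o; rewrite big_nil.
rewrite (_ : (fun o => _) = (fun o => f i o + \sum_(j <- s) f j o)).
  exact: ess_boundedD.
by apply/funext => o; rewrite big_cons.
Qed.

Lemma ess_bounded_le f g : measurable_fun [set: T] f -> ess_bounded g ->
  {ae P, forall o, `|f o| <= g o} -> ess_bounded f.
Proof.
move=> mf [_ [K gK]] fg; split => //; exists K.
apply: filterS2 fg gK => o fo go; apply: (le_trans fo).
exact: le_trans (ler_norm _) go.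
Qed.

Lemma Rintegral_ae_ge0 f : measurable_fun [set: T] f ->
  {ae P, forall o, 0 <= f o} -> 0 <= \int[P]_o f o.
Proof.
move=> mf f0; apply: fine_ge0.
rewrite (@ae_eq_integral _ _ _ P setT (fun o => (Num.max (f o) 0)%:E))//.
- by apply: integral_ge0 => o _; rewrite lee_fin le_max lexx orbT.
- exact/measurable_EFinP.
- by apply/measurable_EFinP; apply: measurable_maxr.
- by apply: filterS f0 => o fo _; rewrite max_l.
Qed.

Lemma ae_le_Rintegral f g : P.-integrable [set: T] (EFin \o f) ->
  P.-integrable [set: T] (EFin \o g) -> {ae P, forall o, f o <= g o} ->
  \int[P]_o f o <= \int[P]_o g o.
Proof.
move=> If Ig fg; rewrite -subr_ge0 -RintegralB//.
have mf : measurable_fun [set: T] f by apply/measurable_EFinP; case/integrableP: If.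
have mg : measurable_fun [set: T] g by apply/measurable_EFinP; case/integrableP: Ig.
apply: Rintegral_ae_ge0; first exact: measurable_funB.
by apply: filterS fg => o fo; rewrite subr_ge0.
Qed.

Lemma Rintegral_prob_cst a : \int[P]_o a = a.
Proof. by rewrite Rintegral_cst//= probability_setT mulr1. Qed.

Lemma Rintegral_sum (I : Type) (s : seq I) (f : I -> T -> R) :
  (forall i, ess_bounded (f i)) ->
  \int[P]_o (\sum_(i <- s) f i o) = \sum_(i <- s) \int[P]_o f i o.
Proof.
move=> bf; elim: s => [|i s IH].
  rewrite big_nil -[RHS](Rintegral_prob_cst 0); congr Rintegral.
  by apply/funext => o; rewrite big_nil.
rewrite big_cons -IH -RintegralD//; first last.
- by apply: ess_bounded_integrable; exact: ess_bounded_sum.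
- exact: ess_bounded_integrable.
by congr Rintegral; apply/funext => o; rewrite big_cons.
Qed.

End essentially_bounded.

Section pull_out.
Context {d d' : measure_display} {T : measurableType d} {T' : measurableType d'}.
Context {R : realType} (P : probability T R) (Y : T -> T') (U : T -> R).
Hypothesis mY : measurable_fun [set: T] Y.
Hypothesis intU : P.-integrable [set: T] (EFin \o U).
Hypothesis U0 : forall A, measurable A -> \int[P]_(o in Y @^-1` A) U o = 0.

Let intUM (v : T' -> R) K : measurable_fun [set: T'] v ->
  (forall y, `|v y| <= K) ->
  P.-integrable [set: T] (EFin \o (fun o => U o * v (Y o))).
Proof.
move=> mv vK; rewrite (_ : _ \o _ = (EFin \o U) \* (EFin \o (v \o Y)))%E//.
apply: integrableMl => //; first exact: measurableT_comp.
exists K; split; first exact: num_real.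
by move=> M KM o _ /=; apply: le_trans (ltW KM); exact: vK.
Qed.

(** Subtracting K/2 times the sign of [v], which is a combination of
    indicators and so integrates to zero against [U], halves the bound on [v]
    without changing the integral. *)
Lemma pull_out_halving n (v : T' -> R) K : measurable_fun [set: T'] v ->
  (forall y, `|v y| <= K) ->
  `|\int[P]_o (U o * v (Y o))| <= K / 2 ^+ n * \int[P]_o `|U o|.
Proof.
elim: n v K => [|n IH] v K mv vK.
  rewrite expr0 divr1; apply: (le_trans (le_normr_Rintegral _ (intUM mv vK))) => //.
  have intaU : P.-integrable [set: T] (EFin \o (fun o => `|U o|)).
    exact: integrable_norm.
  rewrite -RintegralZl//; apply: le_Rintegral => //.
  - exact: (integrable_norm (intUM mv vK)).
  - rewrite (_ : _ \o _ = (fun o => K%:E * (`|U o|)%:E)%E)//.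
    exact: integrableZl.
  - by move=> o _; rewrite normrM mulrC ler_wpM2r.
pose D := v @^-1` `[0, +oo[.
have mD : measurable D by rewrite -[D]setTI; exact: mv.
pose s y : R := \1_D y - 2^-1.
have ms : measurable_fun [set: T'] s.
  by apply: measurable_funB => //; exact: measurable_indic.
have sE y : s y = if 0 <= v y then 2^-1 else - 2^-1.
  rewrite /s indicE; case: ifPn => vy.
    by rewrite mem_set ?/D /= ?in_itv/= ?vy//; lra.
  by rewrite memNset ?/D /= ?in_itv/= ?(negbTE vy)//; lra.
have sK y : `|s y| <= 1 by rewrite sE ler_norml; case: ifP; lra.
have sint : \int[P]_o (U o * s (Y o)) = 0.
  have E1 : \int[P]_o (U o * \1_D (Y o)) = 0.
    rewrite -[RHS](U0 mD) [RHS]Rintegral_mkcond; congr Rintegral; apply/funext => o.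
    rewrite /patch indicE; case: (boolP (o \in Y @^-1` D)).
      by rewrite inE => Do; rewrite mem_set// mulr1.
    by rewrite notin_setE => nDo; rewrite memNset// mulr0.
  have E2 : \int[P]_o U o = 0 by rewrite -(U0 measurableT) preimage_setT.
  have i1 : P.-integrable [set: T] (EFin \o (fun o => U o * \1_D (Y o))).
    apply: (intUM (K := 1)) => [|y]; first exact: measurable_indic.
    by rewrite indicE; case: (y \in D); rewrite ?normr1 ?normr0.
  rewrite (_ : (fun o => _) = (fun o => U o * \1_D (Y o) - 2^-1 * U o)); last first.
    by apply/funext => o; rewrite /s; ring.
  rewrite RintegralB//; first by rewrite RintegralZl// E1 E2 mulr0 subr0.
  rewrite (_ : _ \o _ = (fun o => (2^-1)%:E * (U o)%:E)%E)//.
  exact: integrableZl.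
pose v' y := v y - K * s y.
have mv' : measurable_fun [set: T'] v'.
  by apply: measurable_funB => //; apply: measurable_funM.
have v'K y : `|v' y| <= K / 2.
  rewrite /v' sE ler_norml; have := vK y; rewrite ler_norml => /andP[? ?].
  by case: ifPn; rewrite -?ltNge => ?; lra.
have -> : \int[P]_o (U o * v (Y o)) = \int[P]_o (U o * v' (Y o)).
  rewrite [in RHS](_ : (fun o => _) =
    (fun o => U o * v (Y o) - K * (U o * s (Y o)))); last first.
    by apply/funext => o; rewrite /v'; ring.
  have is' : P.-integrable [set: T] (EFin \o (fun o => U o * s (Y o))).
    exact: intUM sK.
  rewrite RintegralB//.
  - by rewrite RintegralZl// sint mulr0 subr0.
  - exact: intUM vK.
  rewrite (_ : _ \o _ = (fun o => K%:E * (U o * s (Y o))%:E)%E)//.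
  exact: integrableZl.
apply: (le_trans (IH _ _ mv' v'K)).
by rewrite exprS invfM mulrA.
Qed.

(** Letting the number of halvings grow makes the integral arbitrarily small. *)
Lemma pull_out_bounded (v : T' -> R) K : measurable_fun [set: T'] v ->
  (forall y, `|v y| <= K) -> \int[P]_o (U o * v (Y o)) = 0.
Proof.
move=> mv vK; apply/eqP; rewrite -normr_le0.
set x := `|_|; set I1 := \int[P]_o `|U o|.
apply/ler_addgt0Pr => e e0; rewrite add0r.
have KI0 : 0 <= K * I1.
  rewrite mulr_ge0//; last by apply: Rintegral_ge0.
  exact: le_trans (normr_ge0 _) (vK (Y point)).
pose n := Num.truncn (K * I1 / e).
apply: (le_trans (pull_out_halving n mv vK)); rewrite -/I1 mulrAC.
rewrite ler_pdivrMr ?exprn_gt0// [leRHS]mulrC -ler_pdivrMr//.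
have : K * I1 / e < n.+1%:R.
  have KIe : 0 <= K * I1 / e by rewrite divr_ge0// ltW.
  by case/andP: (truncn_itv KIe).
move=> /ltW h; apply: (le_trans h); rewrite -natrX ler_nat; exact: ltn_expl.
Qed.

(** Truncating [v] at its essential bound changes nothing almost surely. *)
Lemma pull_out (v : T' -> R) : measurable_fun [set: T'] v ->
  ess_bounded P (v \o Y) -> \int[P]_o (U o * v (Y o)) = 0.
Proof.
move=> mv [mvY [K vK]].
pose v' y := if `|v y| <= K then v y else 0.
have mv' : measurable_fun [set: T'] v'.
  apply: measurable_fun_ifT => //; apply: measurable_fun_ler => //.
  exact: measurableT_comp.
have v'K y : `|v' y| <= `|K|.
  rewrite /v'; case: ifPn => [h|_]; last by rewrite normr0.
  exact: le_trans h (ler_norm _).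
rewrite -(pull_out_bounded mv' v'K); congr fine.
have mU : measurable_fun [set: T] U.
  by apply/measurable_EFinP; case/integrableP: intU.
apply: ae_eq_integral => //.
- apply/measurable_EFinP; apply: measurable_funM => //; exact: measurableT_comp.
- apply/measurable_EFinP; apply: measurable_funM => //; exact: measurableT_comp.
- by apply: filterS vK => o /= vo _; rewrite /v' vo.
Qed.

End pull_out.

Section conditional_expectation.
Context {R : realType} {N : nat} {d : measure_display} {Omega : measurableType d}.
Context (P : probability Omega R).

(** In each coordinate of the inner product, the factor that is a function of
    the conditioning variable pulls out of the conditional expectation. *)
Lemma cond_exp_orthogonal (X Z : Omega -> 'rV[R]_N) (Y : Omega -> 'rV[R]_N)
    (v : 'rV[R]_N -> 'rV[R]_N) :
  is_cond_exp P X Y Z ->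
  measurable_fun [set: Omega] (Y : Omega -> borelRV R N) ->
  (forall i, ess_bounded P (fun o => X o ord0 i)) ->
  (forall i, ess_bounded P (fun o => Z o ord0 i)) ->
  (forall i, measurable_fun [set: borelRV R N]
    (fun y : borelRV R N => v y ord0 i)) ->
  (forall i, ess_bounded P (fun o => v (Y o) ord0 i)) ->
  ess_bounded P (fun o => dot (Z o - X o) (v (Y o))) /\
  \int[P]_o dot (Z o - X o) (v (Y o)) = 0.
Proof.
move=> XYZ mY bX bZ mv bv.
have bU i : ess_bounded P (fun o => (Z o - X o) ord0 i).
  rewrite (_ : (fun o => _) =
    (fun o => Z o ord0 i + (- 1) * X o ord0 i)); last first.
    by apply/funext => o; rewrite !mxE mulN1r.
  by apply: ess_boundedD => //; exact: ess_boundedZ.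
have bUv i : ess_bounded P (fun o => (Z o - X o) ord0 i * v (Y o) ord0 i).
  exact: ess_boundedM.
split; first exact: ess_bounded_sum.
rewrite [LHS]Rintegral_sum// big1// => i _.
apply: (@pull_out _ _ _ (borelRV R N) _ P Y (fun o => (Z o - X o) ord0 i) mY _ _
  (fun y => v y ord0 i)) => //; [exact: ess_bounded_integrable| |exact: bv].
move=> A mA; have [iX iZ _ XZ] := XYZ i.
have mYA : measurable (Y @^-1` A) by rewrite -[_ @^-1` _]setTI; exact: mY.
have sYA : g_sigma_algebra_preimage (Y : Omega -> borelRV R N) (Y @^-1` A).
  by exists A => //; rewrite setTI.
rewrite (_ : (fun o => _) = (fun o => Z o ord0 i - X o ord0 i)); last first.
  by apply/funext => o; rewrite !mxE.
rewrite RintegralB//; last 2 first.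
- exact: (integrableS measurableT).
- exact: (integrableS measurableT).
by rewrite /Rintegral (XZ _ sYA) subrr.
Qed.

(** Testing the mean against [g w] itself gives
    |g w|^2 <= G |g w|. *)
Lemma unbiased_bounded (gh : 'rV[R]_N -> Omega -> 'rV[R]_N)
    (g : 'rV[R]_N -> 'rV[R]_N) (w : 'rV[R]_N) (G : R) :
  unbiased_at P gh g (fun=> w) -> {ae P, forall o, enorm (gh w o) <= G} ->
  enorm (g w) <= G.
Proof.
move=> unb bd.
have mgh i : measurable_fun [set: Omega] (fun o => gh w o ord0 i).
  by case: (unb i) => iX _ _ _; apply/measurable_EFinP; case/integrableP: iX.
have bgh i : ess_bounded P (fun o => gh w o ord0 i).
  split; first exact: mgh.
  by exists G; apply: filterS bd => o; apply: le_trans; exact: coord_le_enorm.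
have gE i : \int[P]_o (gh w o ord0 i) = g w ord0 i.
  case: (unb i) => iX iZ _ XZ.
  rewrite /Rintegral XZ; last first.
    by exists setT => //; rewrite preimage_setT setIT.
  exact: Rintegral_prob_cst.
have bgg i : ess_bounded P (fun o => gh w o ord0 i * g w ord0 i).
  by apply: ess_boundedM => //; exact: ess_bounded_cst.
have gg : enorm (g w) ^+ 2 = \int[P]_o dot (gh w o) (g w).
  rewrite enorm_sqr [RHS]Rintegral_sum//; apply: eq_bigr => i _.
  by rewrite RintegralZr// ?gE//; exact: ess_bounded_integrable.
have : enorm (g w) ^+ 2 <= G * enorm (g w).
  rewrite gg -[leRHS](Rintegral_prob_cst P); apply: ae_le_Rintegral.
  - by apply: ess_bounded_integrable; exact: ess_bounded_sum.
  - exact/ess_bounded_integrable/ess_bounded_cst.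
  - apply: filterS bd => o go; apply: (le_trans (cauchy_schwarz _ _)).
    by rewrite ler_wpM2r// enorm_ge0.
have [->|g0] := eqVneq (enorm (g w)) 0; last first.
  by rewrite expr2 ler_pM2r// lt_def g0 enorm_ge0.
move=> _; rewrite -(Rintegral_prob_cst P 0) -[leRHS](Rintegral_prob_cst P).
apply: ae_le_Rintegral; [exact/ess_bounded_integrable/ess_bounded_cst..|].
by apply: filterS bd => o; apply: le_trans; exact: enorm_ge0.
Qed.

End conditional_expectation.

(** * Scalar estimates *)

(** From exp (- x) >= 1 - x one gets exp x <= 1 / (1 - x). *)
Lemma expR_le_quadratic (R : realType) (x : R) :
  x <= 2^-1 -> expR x <= 1 + x + 2 * x ^+ 2.
Proof.
move=> x2; have x1 : 0 < 1 - x by lra.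
have h : expR x * (1 - x) <= 1.
  have := expR_ge1Dx (- x); rewrite expRN => h.
  by rewrite mulrC -ler_pdivlMr ?expR_gt0// div1r.
rewrite -(ler_pM2r x1); apply: (le_trans h); nra.
Qed.

Lemma sqr_le_expR (R : realType) (c x : R) : 0 < c -> 0 <= x ->
  x ^+ 2 <= 2 / c ^+ 2 * expR (c * x).
Proof.
move=> c0 x0; rewrite mulrAC ler_pdivlMr ?exprn_gt0//.
have := expR_ge1Dxn 1 (mulr_ge0 (ltW c0) x0); rewrite -[1.+1`!]/2%N exprMn; lra.
Qed.

Lemma telescoped_sum_le (R : realType) (a f : nat -> R) (b k : R) (t n : nat) :
  (forall s, 0 <= a s) -> (forall s, b * f s <= a s - a s.+1 + k) ->
  b * (\sum_(t <= s < t + n) f s) <= a t + n%:R * k.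
Proof.
move=> a0 ak; suff : b * (\sum_(t <= s < t + n) f s) <= a t - a (t + n)%N + n%:R * k.
  by have := a0 (t + n)%N; lra.
elim: n => [|n IH]; first by rewrite addn0 big_geq// mulr0 subrr mul0r addr0.
rewrite addnS big_nat_recr ?leq_addr//= -natr1.
by have := ak (t + n)%N; lra.
Qed.

Section constants.
Context {R : realType} (G e : R).
Hypotheses (e0 : 0 < e) (eG : e <= G).

Let G0 : 0 < G := lt_le_trans e0 eG.

Let den_gt0 : 0 < 24 * G ^+ 2 + 2 * e * G.
Proof. by rewrite addr_gt0 ?mulr_gt0 ?exprn_gt0. Qed.

Lemma r_G_gt0 : 0 < r_G G e.
Proof. by rewrite divr_gt0// mulr_gt0. Qed.

(** The constant r_G is small enough for the quadratic bound on the exponential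
    to apply to increments of size at most r_G G. *)
Lemma r_G_mulG : r_G G e * G <= 8^-1.
Proof.
rewrite /r_G mulrAC ler_pdivrMr//.
have := ler_wpM2r (ltW G0) eG; have := mulr_gt0 e0 G0; lra.
Qed.

(** With this bound the second-order term 2 (r_G G)^2 costs at most half of the
    first-order gain r_G e / 2, which leaves exactly 1 - r_G e / 4 = rho_G. *)
Lemma r_G_mulG2 : r_G G e * G ^+ 2 <= e / 8.
Proof.
rewrite /r_G mulrAC ler_pdivrMr//.
have := mulr_gt0 e0 (mulr_gt0 e0 G0); lra.
Qed.

Lemma rho_GE : rho_G G e = 1 - r_G G e * e / 4.
Proof. by rewrite /rho_G /r_G; field; rewrite gt_eqF. Qed.

Lemma rho_G_lt1 : rho_G G e < 1.
Proof. by rewrite rho_GE; have := mulr_gt0 r_G_gt0 e0; lra. Qed.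

Lemma rho_G_gt0 : 0 < rho_G G e.
Proof.
by rewrite rho_GE; have := r_G_mulG; have := ler_wpM2l (ltW r_G_gt0) eG; lra.
Qed.

(** T_G is the time after which the geometric decay has absorbed the initial
    exponential moment. *)
Lemma rho_G_pow_le1 (alpha d0 : R) (t : nat) : 0 < alpha ->
  T_G G alpha e d0 <= t%:Z ->
  rho_G G e ^+ t * expR (r_G G e / alpha * d0) <= 1.
Proof.
move=> alpha0; have p0 := rho_G_gt0; have p1 := rho_G_lt1.
have lp : 0 < ln (rho_G G e)^-1 by rewrite ln_gt0// invf_gt1.
rewrite /T_G ceil_le_int div1r ler_pdivrMr ?mulr_gt0// => h.
have -> : rho_G G e ^+ t = expR (- (t%:R * ln (rho_G G e)^-1)).
  by rewrite lnV// mulrN opprK expRM_natl lnK.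
rewrite -expRD expR_le1 addrC subr_le0 mulrAC ler_pdivrMr//.
by apply: (le_trans h); rewrite mulrCA mulrC.
Qed.

(** Half of the drift r_G e / 2 pays for the second-order term.  In use, [x] is
    the increment of the exponent in one step and [k] its noise part. *)
Lemma expR_drift (x k : R) : `|x| <= r_G G e * G -> x <= k - r_G G e * e / 2 ->
  expR x <= rho_G G e + k.
Proof.
rewrite rho_GE; have rG := r_G_mulG; have := ler_wpM2l (ltW r_G_gt0) r_G_mulG2.
set r := r_G G e in rG *; clearbody r => rrG2.
rewrite ler_norml => /andP[xge xle] xk.
have x2 : x <= 2^-1 by lra.
have quad := expR_le_quadratic x2.
have p0 : 0 <= r * G - x by lra.
have q0 : 0 <= r * G + x by lra.
have := mulr_ge0 p0 q0; clear - quad rrG2 xk; lra.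
Qed.

Context (alpha : R).
Hypothesis alpha_gt0 : 0 < alpha.
Let r := r_G G e.
Let rho := rho_G G e.

(** Close to the minimizers nothing better than the trivial growth factor is
    used; it is paid for by the additive constant. *)
Lemma exp_growth_near (B x x' : R) : `|x' - x| <= alpha * G -> x <= B ->
  expR (r / alpha * x') <= rho * expR (r / alpha * x)
    + (expR (2 * G * r) - rho) * expR (r * B / alpha).
Proof.
rewrite ler_norml => /andP[_ dx] xB.
have r0 : 0 < r := r_G_gt0; have rho1 : rho < 1 := rho_G_lt1.
have rG0 := mulr_gt0 r0 G0.
clearbody r rho.
have cdx : r / alpha * x' <= r / alpha * x + 2 * G * r.
  rewrite -lerBlDl -mulrBr mulrAC ler_pdivrMr//.
  have := ler_wpM2l (ltW r0) dx; have := mulr_gt0 rG0 alpha_gt0; lra.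
have xB' : r / alpha * x <= r * B / alpha.
  by rewrite mulrAC ler_pM2r ?invr_gt0// ler_pM2l.
have E1 : 1 < expR (2 * G * r) by rewrite expR_gt1; lra.
have k0 : 0 <= expR (2 * G * r) - rho by lra.
move: cdx xB'; rewrite -ler_expR expRD -(ler_expR (_ * x)) => h1.
by move=> /(ler_wpM2l k0) h2; lra.
Qed.

(** Far from the minimizers, the bound on [x' ^+ 2] yields one on [x'] linear in
    the noise, because the square lies above its tangent at [x]. *)
Lemma exp_drift_far (x x' ip ig : R) : 0 < x -> `|x' - x| <= alpha * G ->
  x' ^+ 2 <= x ^+ 2 - 2 * alpha * ip + alpha ^+ 2 * G ^+ 2 ->
  e * x <= ig -> alpha * G ^+ 2 <= e * x ->
  expR (r / alpha * x')
    <= rho * expR (r / alpha * x) + expR (r / alpha * x) * r / x * (ig - ip).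
Proof.
move=> x0 dx sq exig aGx; have r0 : 0 < r := r_G_gt0.
have c0 : 0 < r / alpha by rewrite divr_gt0.
have cG : r / alpha * (alpha * G) = r * G by field; rewrite gt_eqF.
have -> : r / alpha * x' = r / alpha * x + r / alpha * (x' - x) by ring.
have -> : rho * expR (r / alpha * x) + expR (r / alpha * x) * r / x * (ig - ip)
    = expR (r / alpha * x) * (rho + r * (ig - ip) / x) by ring.
rewrite expRD ler_pM2l ?expR_gt0//; apply: expR_drift.
  by rewrite normrM gtr0_norm// -/r -cG ler_pM2l.
rewrite -/r; clearbody r.
have -> : r * (ig - ip) / x - r * e / 2 =
    r / alpha * (alpha * (2 * (ig - ip) - e * x) / (2 * x)).
  by field; rewrite !gt_eqF.
rewrite ler_pM2l// ler_pdivlMr ?mulr_gt0//.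
have tang := sqr_ge0 (x' - x).
have := ler_wpM2l (ltW alpha_gt0) aGx; have := ler_wpM2l (ltW alpha_gt0) exig.
lra.
Qed.

End constants.

(** * One step of the algorithm *)

Section one_step.
Context {R : realType} {N : nat}.
Context (W : set 'rV[R]_N) (F : 'rV[R]_N -> R) (g : 'rV[R]_N -> 'rV[R]_N).
Hypotheses (W_closed : closed W) (W_convex : convex_set W).
Hypothesis F_convex : convex_function W F.
Hypothesis F_min : exists2 w, W w & forall w', W w' -> F w <= F w'.
Hypothesis Wstar_closed : closed (Wstar W F).
Hypothesis g_subgradient : subgradient W F g.
Context (alpha G S : R).
Hypotheses (alpha_gt0 : 0 < alpha) (S_gt0 : 0 < S).

Local Notation e := (eta W F S).
Local Notation dist := (dist_opt W F).
Local Notation step w v := (proj W (w - alpha *: v)).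

Lemma step_move w v : W w -> enorm v <= G -> enorm (step w v - w) <= alpha * G.
Proof.
move=> Ww vG; rewrite -{2}(proj_id W_closed W_convex Ww).
apply: (le_trans (proj_nonexpansive _ _ W_closed W_convex _)); first by exists w.
by rewrite addrAC subrr add0r enormN enormZ gtr0_norm// ler_pM2l.
Qed.

(** The projection onto [W] does not increase the distance to the minimizer
    closest to [w], whose own projection is itself. *)
Lemma step_dist_sqr w v : W w -> enorm v <= G ->
  dist (step w v) ^+ 2 <= dist w ^+ 2 - 2 * alpha * dot v (w - proj (Wstar W F) w)
    + alpha ^+ 2 * G ^+ 2.
Proof.
move=> Ww vG; have [Wp Fp] := proj_Wstar F_min Wstar_closed w.
set p := proj _ w in Wp Fp.
have W0 : W !=set0 by exists w.
apply: (@le_trans _ _ (enorm (w - alpha *: v - p) ^+ 2)).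
  apply: lerXn2r; [exact: enorm_ge0..|].
  apply: (@le_trans _ _ (enorm (step w v - p))).
    by apply: proj_min => //; exact: Wstar_neq0.
  rewrite -{1}(proj_id W_closed W_convex Wp).
  exact: proj_nonexpansive.
have -> : w - alpha *: v - p = (w - proj (Wstar W F) w) - alpha *: v.
  by rewrite addrAC.
rewrite !enorm_sqr dotBZ (dotC v) -(enorm_sqr v) lerD2l ler_pM2l ?exprn_gt0//.
by rewrite ler_sqr ?nnegrE ?enorm_ge0// (le_trans _ vG)// enorm_ge0.
Qed.

Lemma step_gap_descent w v : W w -> enorm v <= G ->
  dist (step w v) ^+ 2 <= dist w ^+ 2 - 2 * alpha * (F w - Fstar W F)
    + alpha ^+ 2 * G ^+ 2 + dot (g w - v) ((2 * alpha) *: (w - proj (Wstar W F) w)).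
Proof.
move=> Ww vG; apply: (le_trans (step_dist_sqr Ww vG)).
have := gap_le_dot F_min Wstar_closed g_subgradient Ww => gap.
rewrite dotZr dotBl; have a2 : 0 <= 2 * alpha by rewrite mulr_ge0// ltW.
have := ler_wpM2l a2 gap; lra.
Qed.

(** On the sphere of radius [S], which is nonempty since eta is positive
    while the infimum of the empty set is 0, the gap is at most |g w| times the distance. *)
Lemma eta_le_G : 0 < e -> (forall w, W w -> enorm (g w) <= G) -> e <= G.
Proof.
move=> e0 gG.
have [[w [Ww wS]]|sph0] := pselect (sphere_opt W F S !=set0); last first.
  suff : e = 0 by move=> e00; rewrite e00 ltxx in e0.
  rewrite /eta (_ : [set _ | _ in _] = set0) ?inf0//.
  by apply/seteqP; split => // x [w Sw _]; apply: sph0; exists w.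
have Sw : S <= dist w by rewrite wS.
have h1 := gap_ge_eta W_convex F_convex F_min Wstar_closed S_gt0 Ww Sw.
have h2 := gap_le_dot F_min Wstar_closed g_subgradient Ww.
have h3 := le_trans (le_trans h1 h2) (cauchy_schwarz _ _).
have d0 : 0 < dist w := lt_le_trans S_gt0 Sw.
rewrite -(ler_pM2r d0); apply: (le_trans h3).
by rewrite ler_pM2r// gG.
Qed.

Local Notation B := (B_G G alpha S e).
Local Notation r := (r_G G e).
Local Notation rho := (rho_G G e).

(** The noise enters the exponential drift inequality through its inner product
    with this vector, a function of the current iterate alone. *)
Definition drift_direction w : 'rV[R]_N :=
  if B < dist w
  then (expR (r / alpha * dist w) * r / dist w) *: (w - proj (Wstar W F) w)
  else 0.

(** Both regimes in one pointwise inequality: the additive constant serves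
    within radius B_G, the noise term beyond it. *)
Lemma step_exp_drift w v : 0 < e -> e <= G -> W w -> enorm v <= G ->
  expR (r / alpha * dist (step w v)) <= rho * expR (r / alpha * dist w)
    + (expR (2 * G * r) - rho) * expR (r * B / alpha)
    + dot (g w - v) (drift_direction w).
Proof.
move=> e0 eG Ww vG.
have dx : `|dist (step w v) - dist w| <= alpha * G.
  apply: le_trans (step_move Ww vG); rewrite ler_norml lerBlDl lerNl opprB lerBlDl.
  by rewrite dist_opt_lipschitz// [in leRHS]enormBC dist_opt_lipschitz.
rewrite /drift_direction; case: ltP => Bd; last first.
  rewrite -(scale0r (0 : 'rV[R]_N)) dotZr mul0r addr0.
  exact: exp_growth_near.
have [SB GB] : S <= B /\ alpha * G ^+ 2 / e <= B.
  by rewrite /B_G !le_max !lexx !orbT.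
have Sd : S <= dist w by rewrite ltW// (le_lt_trans SB).
have d0 : 0 < dist w := lt_le_trans S_gt0 Sd.
have gap := gap_ge_eta W_convex F_convex F_min Wstar_closed S_gt0 Ww Sd.
have sub := gap_le_dot F_min Wstar_closed g_subgradient Ww.
have aG : alpha * G ^+ 2 <= e * dist w.
  by rewrite [leRHS]mulrC -ler_pdivrMr// ltW// (le_lt_trans GB).
rewrite dotZr dotBl addrAC.
apply: (le_trans (exp_drift_far e0 eG alpha_gt0 d0 dx (step_dist_sqr Ww vG)
  (le_trans gap sub) aG)).
rewrite lerDl mulr_ge0 ?expR_ge0// subr_ge0 ltW// (lt_trans (rho_G_lt1 e0 eG))//.
by rewrite expR_gt1 mulr_gt0 ?r_G_gt0// mulr_gt0// (lt_le_trans e0).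
Qed.

End one_step.

(** * The random iterates *)

Section process.
Context {R : realType} {N : nat} {d : measure_display} {Omega : measurableType d}.
Context (P : probability Omega R).
Context (W : set 'rV[R]_N) (F : 'rV[R]_N -> R) (g : 'rV[R]_N -> 'rV[R]_N).
Context (gh : nat -> 'rV[R]_N -> Omega -> 'rV[R]_N) (w0 : 'rV[R]_N) (alpha G : R).
Hypotheses (W_closed : closed W) (W_convex : convex_set W).
Hypotheses (F_continuous : {within W, continuous F}).
Hypothesis F_convex : convex_function W F.
Hypothesis g_subgradient : subgradient W F g.
Hypothesis F_min : exists2 w, W w & forall w', W w' -> F w <= F w'.
Hypothesis Wstar_closed : closed (Wstar W F).
Hypothesis gh_bounded : forall t : nat,
  {ae P, forall o, forall w, W w -> enorm (gh t w o) <= G}.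
Hypothesis g_bounded : forall w, W w -> enorm (g w) <= G.
Hypotheses (w0_W : W w0) (alpha_gt0 : 0 < alpha).
Hypothesis gh_unbiased_iterate : forall t : nat,
  unbiased_at P (gh t) g (iterate W alpha gh w0 t).

Local Notation w := (iterate W alpha gh w0).
Local Notation dist := (dist_opt W F).
Local Notation X t o := (dist (w t o)).
Local Notation ghw t o := (gh t (w t o) o).
Local Notation Fs := (Fstar W F).
Local Notation gap t o := (F (w t o) - Fs).
Local Notation h y := (y - proj (Wstar W F) y).

Let W_neq0 : W !=set0. Proof. by exists w0. Qed.

Lemma iterate_in t o : W (w t o).
Proof. by case: t => //= t; exact: proj_in. Qed.

Let oracle_bounded t : {ae P, forall o, enorm (ghw t o) <= G}.
Proof. by apply: filterS (gh_bounded t) => o; apply; exact: iterate_in. Qed.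

Let measurable_oracle t i : measurable_fun [set: Omega] (fun o => ghw t o ord0 i).
Proof.
case: (gh_unbiased_iterate t i) => iX _ _ _.
by apply/measurable_EFinP; case/integrableP: iX.
Qed.

(** The oracle answers are measurable along the iterates since they are
    integrable, and the projection is continuous. *)
Lemma measurable_iterate t :
  measurable_fun [set: Omega] (w t : Omega -> borelRV R N).
Proof.
elim: t => [|t IH]; first exact: measurable_cst.
apply: (measurableT_comp (f := proj W : borelRV R N -> borelRV R N)
   (g := (fun o => w t o - alpha *: ghw t o) : Omega -> borelRV R N)).
  by apply: continuous_borel_measurable_rV; exact: proj_continuous.
apply: coord_measurable_rV => i.
rewrite (_ : (fun o => _) =
    (fun o => w t o ord0 i - alpha * ghw t o ord0 i)); last first.
  by apply/funext => o; rewrite !mxE.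
apply: measurable_funB; last exact: measurable_funM.
apply: (measurableT_comp (f := (fun y => y ord0 i) : borelRV R N -> R) _ IH).
by apply: continuous_borel_measurable; exact: coord_continuous.
Qed.

Lemma measurable_continuous_iterate (f : 'rV[R]_N -> R) t : continuous f ->
  measurable_fun [set: Omega] (fun o => f (w t o)).
Proof.
move=> fc.
apply: (measurableT_comp (f := f : borelRV R N -> R) _ (measurable_iterate t)).
exact: continuous_borel_measurable.
Qed.

Let dist_continuous : continuous dist.
Proof. exact: dist_opt_continuous. Qed.

(** Each step moves the iterate by at most alpha G, so the distance grows at
    most linearly in time. *)
Lemma ess_bounded_dist t : ess_bounded P (fun o => X t o).
Proof.
split; first exact: measurable_continuous_iterate.
exists (dist w0 + t%:R * (alpha * G)).
elim: t => [|t IH].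
  by apply: aeW => o; rewrite mul0r addr0 ger0_norm// dist_opt_ge0.
apply: filterS2 IH (oracle_bounded t) => o.
rewrite !ger0_norm ?dist_opt_ge0// => IH go.
apply: (le_trans (dist_opt_lipschitz F_min Wstar_closed _ (w t o))).
have mv := step_move W_closed W_convex alpha_gt0 (iterate_in t o) go.
by rewrite -natr1 mulrDl mul1r addrA lerD.
Qed.

Lemma gap_ge0 t o : 0 <= gap t o.
Proof. by rewrite subr_ge0; apply: Fstar_le => //; exact: iterate_in. Qed.

Lemma gap_le_dist y : W y -> F y - Fs <= G * dist y.
Proof.
move=> Wy; apply: (le_trans (gap_le_dot F_min Wstar_closed g_subgradient Wy)).
apply: (le_trans (cauchy_schwarz _ _)).
by rewrite ler_wpM2r ?dist_opt_ge0// g_bounded.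
Qed.

(** The gap is measurable because it only involves [F] on [W], where [F]
    agrees with the continuous function [F \o proj W]. *)
Lemma ess_bounded_gap t : ess_bounded P (fun o => gap t o).
Proof.
apply: (ess_bounded_le _ (ess_boundedZ G (ess_bounded_dist t))).
  apply: measurable_funB => //.
  rewrite (_ : (fun o => _) = (fun o => (F \o proj W) (w t o))); last first.
    by apply/funext => o /=; rewrite proj_id//; exact: iterate_in.
  by apply: measurable_continuous_iterate; exact: continuous_comp_proj.
apply: aeW => o; rewrite ger0_norm ?gap_ge0//.
by apply: gap_le_dist; exact: iterate_in.
Qed.

Lemma noise_orthogonal t (v : 'rV[R]_N -> 'rV[R]_N) :
  (forall i, measurable_fun [set: borelRV R N]
    (fun y : borelRV R N => v y ord0 i)) ->
  (forall i, ess_bounded P (fun o => v (w t o) ord0 i)) ->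
  ess_bounded P (fun o => dot (g (w t o) - ghw t o) (v (w t o))) /\
  \int[P]_o dot (g (w t o) - ghw t o) (v (w t o)) = 0.
Proof.
move=> mv bv; apply: cond_exp_orthogonal => //.
- exact: gh_unbiased_iterate.
- exact: measurable_iterate.
- move=> i; split; first exact: measurable_oracle.
  exists G; apply: filterS (oracle_bounded t) => o; apply: le_trans.
  exact: coord_le_enorm.
- move=> i; split.
    case: (gh_unbiased_iterate t i) => _ iZ _ _.
    by apply/measurable_EFinP; case/integrableP: iZ.
  exists G; apply: aeW => o; apply: (le_trans (coord_le_enorm _ _)).
  by apply: g_bounded; exact: iterate_in.
Qed.

Lemma measurable_offset i :
  measurable_fun [set: borelRV R N] (fun y : borelRV R N => (h y) ord0 i).
Proof.
rewrite (_ : (fun y => _) =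
    (fun y : 'rV[R]_N => y ord0 i - proj (Wstar W F) y ord0 i)); last first.
  by apply/funext => y; rewrite !mxE.
apply: measurable_funB; apply: continuous_borel_measurable.
  exact: coord_continuous.
move=> y; apply: (@continuous_comp _ _ _ (proj (Wstar W F)) (fun z => z ord0 i)).
  by apply: proj_continuous => //; [exact: Wstar_convex|exact: Wstar_neq0].
exact: coord_continuous.
Qed.

Let measurable_dist : measurable_fun [set: borelRV R N] (dist : borelRV R N -> R).
Proof. exact: continuous_borel_measurable. Qed.

Lemma expected_gap_descent t :
  2 * alpha * \int[P]_o gap t o
    <= \int[P]_o (X t o ^+ 2) - \int[P]_o (X t.+1 o ^+ 2) + alpha ^+ 2 * G ^+ 2.
Proof.
pose v y : 'rV[R]_N := (2 * alpha) *: h y.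
have mv i : measurable_fun [set: borelRV R N] (fun y : borelRV R N => v y ord0 i).
  rewrite (_ : (fun y => _) = (fun y => (2 * alpha) * (h y) ord0 i)).
    by apply: measurable_funM => //; exact: measurable_offset.
  by apply/funext => y; rewrite mxE.
have bv i : ess_bounded P (fun o => v (w t o) ord0 i).
  apply: (ess_bounded_le _ (ess_boundedZ (2 * alpha) (ess_bounded_dist t))).
    exact: (measurableT_comp (f := (fun y => v y ord0 i) : borelRV R N -> R) (mv i)
      (measurable_iterate t)).
  have a0 : 0 <= 2 * alpha by rewrite mulr_ge0// ltW.
  by apply: aeW => o; rewrite mxE normrM ger0_norm// ler_wpM2l// coord_le_enorm.
have [bn n0] := noise_orthogonal mv bv.
have b1 := ess_boundedX 2 (ess_bounded_dist t).
have b2 := ess_boundedX 2 (ess_bounded_dist t.+1).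
have b3 := ess_boundedZ (- (2 * alpha)) (ess_bounded_gap t).
have b4 := ess_bounded_cst P (alpha ^+ 2 * G ^+ 2).
have b13 := ess_boundedD b1 b3; have b134 := ess_boundedD b13 b4.
have i5 := ess_bounded_integrable (ess_boundedD b134 bn).
have in_ := ess_bounded_integrable bn; have i134 := ess_bounded_integrable b134.
have i13 := ess_bounded_integrable b13; have i4 := ess_bounded_integrable b4.
have i1 := ess_bounded_integrable b1; have i3 := ess_bounded_integrable b3.
have ig := ess_bounded_integrable (ess_bounded_gap t).
have i2 := ess_bounded_integrable b2.
have hle : \int[P]_o (X t.+1 o ^+ 2) <= \int[P]_o
   (X t o ^+ 2 + - (2 * alpha) * gap t o
   + alpha ^+ 2 * G ^+ 2 + dot (g (w t o) - ghw t o) (v (w t o))).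
  apply: ae_le_Rintegral => //.
  apply: filterS (oracle_bounded t) => o go.
  have := step_gap_descent W_closed W_convex F_min Wstar_closed g_subgradient
    alpha_gt0 (iterate_in t o) go.
  by rewrite mulNr.
rewrite (RintegralD measurableT i134 in_) (RintegralD measurableT i13 i4) in hle.
rewrite (RintegralD measurableT i1 i3) in hle.
rewrite n0 RintegralZl// Rintegral_prob_cst addr0 mulNr in hle.
rewrite [leRHS]addrAC lerBrDl in hle.
by rewrite [leRHS]addrAC lerBrDr.
Qed.

Section drift.
Context (S : R).
Hypothesis S_gt0 : 0 < S.
Local Notation e := (eta W F S).
Hypotheses (e0 : 0 < e) (eG : e <= G).
Local Notation r := (r_G G e).
Local Notation c := (r / alpha).
Local Notation rho := (rho_G G e).
Local Notation D := (D_G G alpha S e).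

Let G0 : 0 < G := lt_le_trans e0 eG.
Let r0 : 0 < r := r_G_gt0 e0 eG.
Let c0 : 0 < c := divr_gt0 r0 alpha_gt0.

Lemma ess_bounded_exp_dist t : ess_bounded P (fun o => expR (c * X t o)).
Proof. by apply: ess_bounded_expR; apply: ess_boundedZ; exact: ess_bounded_dist. Qed.

Lemma expected_exp_drift t :
  \int[P]_o expR (c * X t.+1 o) <= rho * \int[P]_o expR (c * X t o) + (1 - rho) * D.
Proof.
pose v := drift_direction W F alpha G S.
have vE y i : v y ord0 i = if B_G G alpha S e < dist y
    then expR (c * dist y) * r / dist y * (h y) ord0 i else 0.
  by rewrite /v /drift_direction; case: ifP => _; rewrite !mxE.
have B0 : 0 < B_G G alpha S e.
  by rewrite (lt_le_trans S_gt0)// /B_G !le_max lexx orbT.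
have mv i : measurable_fun [set: borelRV R N] (fun y : borelRV R N => v y ord0 i).
  (* where it matters, 1 / dist is exp (- ln dist), a measurable expression *)
  rewrite (_ : (fun y => _) = (fun y => if B_G G alpha S e < dist y
    then expR (c * dist y - ln (dist y)) * r * (h y) ord0 i else 0)); last first.
    apply/funext => y; rewrite vE; case: ifP => // By.
    have d0 : 0 < dist y := lt_trans B0 By.
    by rewrite expRD expRN lnK ?posrE// (mulrAC _ r).
  apply: measurable_fun_ifT => //; first exact: measurable_fun_ltr.
  apply: measurable_funM; last exact: measurable_offset.
  apply: measurable_funM => //; apply: measurableT_comp => //.
  by apply: measurable_funB; [exact: measurable_funM|exact: measurableT_comp].
have bv i : ess_bounded P (fun o => v (w t o) ord0 i).
  apply: (ess_bounded_le _ (ess_boundedZ r (ess_bounded_exp_dist t))).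
    exact: (measurableT_comp (f := (fun y => v y ord0 i) : borelRV R N -> R) (mv i)
      (measurable_iterate t)).
  apply: aeW => o; rewrite vE.
  have E0 := expR_gt0 (c * X t o).
  case: ifP => [Bd|_]; last by rewrite normr0 mulr_ge0// ltW.
  have d0 : 0 < dist (w t o) := lt_trans B0 Bd.
  have k0 : 0 <= expR (c * dist (w t o)) * r / dist (w t o).
    by apply: divr_ge0; [apply: mulr_ge0; exact: ltW|exact: ltW].
  rewrite normrM ger0_norm//.
  apply: (@le_trans _ _ (expR (c * dist (w t o)) * r / dist (w t o) * dist (w t o))).
    by apply: ler_wpM2l; last exact: coord_le_enorm.
  by rewrite divfK ?gt_eqF// mulrC.
have [bn n0] := noise_orthogonal mv bv.
have b1 := ess_boundedZ rho (ess_bounded_exp_dist t).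
have b2 := ess_bounded_cst P
  ((expR (2 * G * r) - rho) * expR (r * B_G G alpha S e / alpha)).
have b12 := ess_boundedD b1 b2.
have i := ess_bounded_integrable (ess_boundedD b12 bn).
have in_ := ess_bounded_integrable bn; have i12 := ess_bounded_integrable b12.
have i1 := ess_bounded_integrable b1; have i2 := ess_bounded_integrable b2.
have iE t' := ess_bounded_integrable (ess_bounded_exp_dist t').
have : \int[P]_o expR (c * X t.+1 o) <= \int[P]_o (rho * expR (c * X t o) +
   (expR (2 * G * r) - rho) * expR (r * B_G G alpha S e / alpha)
   + dot (g (w t o) - ghw t o) (v (w t o))).
  apply: ae_le_Rintegral => //.
  apply: filterS (oracle_bounded t) => o go.
  exact: (step_exp_drift W_closed W_convex F_convex F_min Wstar_closed g_subgradient
    alpha_gt0 S_gt0 e0 eG (iterate_in t o) go).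
rewrite (RintegralD measurableT i12 in_) (RintegralD measurableT i1 i2) n0.
rewrite RintegralZl//.
rewrite Rintegral_prob_cst addr0.
have rho1 : 1 - rho != 0 by rewrite gt_eqF// subr_gt0; exact: rho_G_lt1.
by rewrite /D_G [(1 - rho) * _]mulrC divfK.
Qed.

(** D_G is the fixed point of the affine recursion [expected_exp_drift]. *)
Lemma expected_exp_dist_le t :
  \int[P]_o expR (c * X t o) <= rho ^+ t * expR (c * dist w0) + D.
Proof.
have rho0 : 0 < rho := rho_G_gt0 e0 eG.
have rho1 : rho < 1 := rho_G_lt1 e0 eG.
elim: t => [|t IH].
  rewrite /= Rintegral_prob_cst expr0 mul1r lerDl /D_G.
  apply: divr_ge0; last by rewrite subr_ge0 ltW.
  apply: mulr_ge0; last exact: expR_ge0.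
  have : 1 < expR (2 * G * r) by rewrite expR_gt1; have := mulr_gt0 G0 r0; lra.
  lra.
apply: (le_trans (expected_exp_drift t)).
have := ler_wpM2l (ltW rho0) IH; rewrite exprS; lra.
Qed.

Lemma expected_dist_sqr_le t : T_G G alpha e (dist w0) <= t%:Z ->
  \int[P]_o (X t o ^+ 2) <= alpha ^+ 2 * U_G G alpha S e.
Proof.
move=> tT; have := rho_G_pow_le1 e0 eG alpha_gt0 tT => pow1.
have h1 := expected_exp_dist_le t.
have b1 := ess_bounded_exp_dist t.
have : \int[P]_o (X t o ^+ 2) <= \int[P]_o (2 / c ^+ 2 * expR (c * X t o)).
  apply: ae_le_Rintegral.
  - by apply: ess_bounded_integrable; apply: ess_boundedX; exact: ess_bounded_dist.
  - by apply: ess_bounded_integrable; exact: ess_boundedZ.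
  by apply: aeW => o; apply: sqr_le_expR => //; exact: dist_opt_ge0.
rewrite RintegralZl//; last exact: ess_bounded_integrable.
move=> h2; apply: (le_trans h2).
have -> : alpha ^+ 2 * U_G G alpha S e = 2 / c ^+ 2 * (1 + D).
  by rewrite /U_G; field; rewrite !gt_eqF.
rewrite ler_wpM2l ?divr_ge0 ?sqr_ge0//; lra.
Qed.

End drift.

Lemma expected_average_gap t T : (0 < T)%N ->
  ('E_P[fun o => F (average W alpha gh w0 t T o)] - (Fstar W F)%:E
   <= (T%:R^-1 * \sum_(t <= s < t + T) \int[P]_o gap s o)%:E)%E.
Proof.
move=> T0; set wb := average W alpha gh w0 t T.
have jen o := jensen_average W_convex F_convex t (fun s => iterate_in s o) T0.
have Wb o : W (wb o) by case: (jen o).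
have Fb o : F (wb o) - Fs <= T%:R^-1 * \sum_(t <= s < t + T) gap s o.
  have [_] := jen o; rewrite -/(wb o) => h1.
  rewrite sumrB mulrBr sumr_const_nat addKn -[Fs *+ T]mulr_natl.
  rewrite mulKf ?pnatr_eq0 -?lt0n//.
  by rewrite lerD2r.
have mb : measurable_fun [set: Omega] (fun o => F (wb o)).
  rewrite (_ : (fun o => _) = (fun o => (F \o proj W) (wb o))); last first.
    by apply/funext => o /=; rewrite proj_id.
  apply: (measurableT_comp (f := F \o proj W : borelRV R N -> R)
    (g := wb : Omega -> borelRV R N)).
    by apply: continuous_borel_measurable; exact: continuous_comp_proj.
  apply: coord_measurable_rV => i.
  rewrite (_ : (fun o => _) =
      (fun o => T%:R^-1 * \sum_(t <= s < t + T) w s o ord0 i)); last first.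
    by apply/funext => o; rewrite /wb /average mxE summxE.
  apply: measurable_funM => //; apply: measurable_sum => s.
  apply: (measurable_continuous_iterate (f := fun y => y ord0 i)).
  exact: coord_continuous.
have bs : ess_bounded P (fun o => T%:R^-1 * \sum_(t <= s < t + T) gap s o).
  by apply: ess_boundedZ; apply: ess_bounded_sum => s; exact: ess_bounded_gap.
have bb : ess_bounded P (fun o => F (wb o) - Fs).
  apply: (ess_bounded_le _ bs); first exact: measurable_funB.
  by apply: aeW => o; rewrite ger0_norm// subr_ge0; exact: Fstar_le.
have bF : ess_bounded P (fun o => F (wb o)).
  rewrite (_ : (fun o => _) = (fun o => F (wb o) - Fs + Fs)); last first.
    by apply/funext => o; rewrite subrK.
  by apply: ess_boundedD => //; exact: ess_bounded_cst.
have iF := ess_bounded_integrable bF.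
rewrite unlock -[z in (z - _)%E]fineK; last exact: integrable_fin_num.
rewrite -EFinB lee_fin -/(Rintegral P setT (fun o => F (wb o))).
rewrite -{1}(Rintegral_prob_cst P Fs) -RintegralB//; last first.
  exact/ess_bounded_integrable/ess_bounded_cst.
rewrite -Rintegral_sum//; last by move=> s; exact: ess_bounded_gap.
rewrite -RintegralZl//; last first.
  apply: ess_bounded_integrable; apply: ess_bounded_sum => s.
  exact: ess_bounded_gap.
apply: ae_le_Rintegral; [exact: ess_bounded_integrable..|exact: aeW].
Qed.

Lemma telescoped_gap_sum t T :
  2 * alpha * (\sum_(t <= s < t + T) \int[P]_o gap s o)
    <= \int[P]_o (X t o ^+ 2) + T%:R * (alpha ^+ 2 * G ^+ 2).
Proof.
apply: (telescoped_sum_le (a := fun s => \int[P]_o (X s o ^+ 2))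
  (f := fun s => \int[P]_o gap s o)) => s; last exact: expected_gap_descent.
by apply: Rintegral_ge0 => o _; exact: sqr_ge0.
Qed.

End process.

(** * The convergence bound *)

Theorem theorem2 (R : realType) (N : nat)
    (d : measure_display) (Omega : measurableType d) (P : probability Omega R)
    (W : set 'rV[R]_N) (F : 'rV[R]_N -> R) (g : 'rV[R]_N -> 'rV[R]_N)
    (gh : nat -> 'rV[R]_N -> Omega -> 'rV[R]_N)
    (w0 : 'rV[R]_N) (alpha G : R)
    (W_closed : closed W) (W_convex : convex_set W)
    (F_continuous : {within W, continuous F}) (F_convex : convex_function W F)
    (g_subgradient : subgradient W F g)
    (F_min : exists2 w, W w & forall w', W w' -> F w <= F w')
    (Wstar_closed : closed (Wstar W F))
    (gh_bounded : forall t : nat,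
       {ae P, forall o, forall w, W w -> enorm (gh t w o) <= G})
    (gh_unbiased : forall (t : nat) (w : 'rV[R]_N),
       W w -> unbiased_at P (gh t) g (fun=> w))
    (w0_W : W w0) (alpha_gt0 : 0 < alpha)
    (gh_unbiased_iterate : forall t : nat,
       unbiased_at P (gh t) g (iterate W alpha gh w0 t))
    (Smax_gt0 : (0 < Smax W F)%E)
    (S : R) (S_gt0 : 0 < S) (S_lt : (S%:E < Smax W F)%E)
    (eta_gt0 : 0 < eta W F S)
    (t : nat) (t_ge : T_G G alpha (eta W F S) (dist_opt W F w0) <= t%:Z)
    (T : nat) (T_gt0 : (0 < T)%N) :
  ('E_P[fun o => F (average W alpha gh w0 t T o)] - (Fstar W F)%:E
   <= (alpha * G ^+ 2 / 2 + alpha * U_G G alpha S (eta W F S) / (2 * T%:R))%:E)%E.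
Proof.
have g_bounded w : W w -> enorm (g w) <= G.
  move=> Ww; apply: unbiased_bounded (gh_unbiased 0%N w Ww) _.
  by apply: filterS (gh_bounded 0%N) => o; apply.
have eG : eta W F S <= G.
  exact: (eta_le_G W_convex F_convex F_min Wstar_closed g_subgradient
    S_gt0 eta_gt0 g_bounded).
apply: le_trans (expected_average_gap W_closed W_convex F_continuous F_convex
  g_subgradient F_min Wstar_closed gh_bounded g_bounded w0_W alpha_gt0
  gh_unbiased_iterate t T_gt0) _.
have h1 := expected_dist_sqr_le W_closed W_convex F_convex
  g_subgradient F_min Wstar_closed gh_bounded g_bounded w0_W alpha_gt0
  gh_unbiased_iterate S_gt0 eta_gt0 eG t_ge.
have h2 := telescoped_gap_sum W_closed W_convex F_continuous F_convex
  g_subgradient F_min Wstar_closed gh_bounded g_bounded w0_W alpha_gt0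
  gh_unbiased_iterate t T.
have T0 : 0 < T%:R :> R by rewrite ltr0n.
set s := \sum_(_ <= _ < _) _ in h2 *; set U := U_G _ _ _ _ in h1 *.
rewrite lee_fin -(ler_pM2l (_ : 0 < 2 * alpha * T%:R)) ?mulr_gt0//.
have -> : 2 * alpha * T%:R * (T%:R^-1 * s) = 2 * alpha * s by field; rewrite gt_eqF.
have -> : 2 * alpha * T%:R * (alpha * G ^+ 2 / 2 + alpha * U / (2 * T%:R)) =
  alpha ^+ 2 * U + T%:R * (alpha ^+ 2 * G ^+ 2) by field; rewrite gt_eqF.
lra.
Qed.
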